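(* Let $k\ge 1$ and $n\ge 1$ be integers, let $\omega=(\omega_1,\omega_2,\ldots)$ be a sequence of integers (the weight vector), let $t_1,\ldots,t_k$ be indeterminates, and set $t_j:=0$ for $j>k$. Define the weighted isobaric polynomial $$P_{\omega,k,n}(t_1,\ldots,t_k)=\sum_{\alpha\vdash n}\binom{|\alpha|}{\alpha_1,\ldots,\alpha_k}\frac{\sum_{j=1}^k\omega_j\alpha_j}{|\alpha|}\,t_1^{\alpha_1}\cdots t_k^{\alpha_k},$$ where the sum runs over all $k$-tuples $\alpha=(\alpha_1,\ldots,\alpha_k)$ of nonnegative integers with $\sum_{j=1}^k j\alpha_j=n$, and $|\alpha|=\alpha_1+\cdots+\alpha_k$. Let $H_{+}$ be the $n\times n$ lower Hessenberg matrix whose entries are: for $1\le i\le n-1$, $(H_+)_{i,j}=t_{i-j+1}$ if $j\le i$, $(H_+)_{i,i+1}=1$, and $(H_+)_{i,j}=0$ if $j>i+1$; and in the last row $(H_+)_{n,j}=\omega_{n-j+1}t_{n-j+1}$ for $1\le j\le n$. That is, $$H_{+}=\begin{pmatrix} t_1&1&0&\cdots&0\\ t_2&t_1&1&\cdots&0\\ \vdots&\vdots&\vdots&\ddots&\vdots\\ t_{n-1}&t_{n-2}&t_{n-3}&\cdots&1\\ \omega_nt_n&\omega_{n-1}t_{n-1}&\omega_{n-2}t_{n-2}&\cdots&\omega_1t_1\end{pmatrix}.$$ Let $H_-$ be the same matrix except that every super-diagonal entry $1$ is replaced by $-1$. Then (a) $\operatorname{perm} H_+ = P_{\omega,k,n}(t_1,\ldots,t_k)$,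 and (b) $\det H_- = P_{\omega,k,n}(t_1,\ldots,t_k)$.
   Context: The permanent of a square matrix $M=(m_{ij})_{1\le i,j\le n}$ is $\operatorname{perm}M=\sum_{\sigma\in S_n}\prod_{i=1}^n m_{i,\sigma(i)}$, i.e. the determinant expansion with all signs taken to be $+$. *)

(* Defs.v *)
From HB Require Import structures.
From mathcomp Require Import all_boot all_order all_algebra all_fingroup.
From mathcomp Require Import mpoly.
Set Implicit Arguments. Unset Strict Implicit. Unset Printing Implicit Defensive.
Import Order.TTheory GRing.Theory Num.Theory.
Local Open Scope ring_scope.

Definition permanent (R : comNzRingType) (n : nat) (M : 'M[R]_n) : R :=
  \sum_(s : 'S_n) \prod_(i < n) M i (s i).

Definition multinomial (s : seq nat) : nat :=
  ((sumn s)`! %/ \prod_(x <- s) x`!)%N.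

(* t_j (1-based): the j-th indeterminate 'X_(j-1) for 1 <= j <= k, and 0 otherwise. *)
Definition tvar (k : nat) (j : nat) : {mpoly rat[k]} :=
  if (0 < j)%N then
    (if (insub j.-1 : option 'I_k) is Some i then 'X_i else 0)
  else 0.

(* The Hessenberg matrix H_s (0-based indices i, j : 'I_n), with super-diagonal
   entries equal to s (s = 1 gives H_+, s = -1 gives H_-).
   Weights w are 1-based: w j = omega_j (w 0 unused). *)
Definition Hmat (k n : nat) (w : nat -> int) (s : {mpoly rat[k]}) : 'M[{mpoly rat[k]}]_n :=
  \matrix_(i < n, j < n)
    if (i.+1 == n :> nat)%N then ((w (n - j)%N)%:~R : rat) *: tvar k (n - j)
    else if (j <= i)%N then tvar k (i - j).+1
    else if (j == i.+1 :> nat)%N then s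
    else 0.

(* The weighted isobaric polynomial P_{omega,k,n}(t_1,...,t_k).
   alpha ranges over k-tuples of nonnegative integers with sum_j j*alpha_j = n
   (each alpha_j <= n automatically, so bounding by 'I_n.+1 loses nothing). *)
Definition Pw (k n : nat) (w : nat -> int) : {mpoly rat[k]} :=
  \sum_(a : {ffun 'I_k -> 'I_n.+1} | (\sum_(j < k) j.+1 * a j)%N == n)
    (((multinomial [seq (a j : nat) | j <- enum 'I_k])%:R : rat)
      * ((\sum_(j < k) ((w j.+1)%:~R : rat) * (a j)%:R)
          / ((\sum_(j < k) (a j : nat))%N)%:R))
    *: \prod_(j < k) 'X_j ^+ a j.

Arguments tvar k j : clear implicits.
Arguments Hmat k n w s : clear implicits.
Arguments Pw k n w : clear implicits.

(* Main.v *)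
Require Import Defs.
From HB Require Import structures.
From mathcomp Require Import all_boot all_order all_algebra all_fingroup.
From mathcomp Require Import mpoly.
From mathcomp Require Import zify ring.
Set Implicit Arguments. Unset Strict Implicit. Unset Printing Implicit Defensive.
Import Order.TTheory GRing.Theory Num.Theory.
Local Open Scope ring_scope.

(* Expanding the permanent or the determinant of H_(+/-) along its last column
   leaves only two nonzero entries: the corner w_1 t_1, whose minor is the
   unweighted matrix of size n - 1, and the super-diagonal entry +/-1, whose
   minor is the matrix of size n - 1 whose last row is shifted by one index
   (the signs of the cofactor and of the entry cancel for the determinant).
   Unrolling this recursion gives
     F_n(w) = sum_(i < n) w_(i+1) t_(i+1) q_(n-1-i),
   where q_d is the unweighted value at size d.  With all weights 1 this is the
   convolution recursion of the complete homogeneous series 1/(1 - sum_j t_j x^j),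
   so the coefficient of t^m in q_d is the multinomial coefficient of m when
   sum_j j m_j = d.  Feeding this back, the coefficient of t^m in F_n(w) is
   sum_j w_j multinomial(m - e_j) = multinomial(m) (sum_j w_j m_j) / |m|. *)

Section Permanent.
Variable R : comNzRingType.

Lemma expand_permanent_minor n (A : 'M[R]_n) i0 j0 :
  permanent (row' i0 (col' j0 A)) =
    \sum_(s : 'S_n | s i0 == j0) \prod_(k | i0 != k) A k (s k).
Proof.
case: n A i0 j0 => [|n] A i0 j0; first by case: i0.
rewrite (reindex (lift_perm i0 j0)); last first.
  pose ulsf i (s : 'S_n.+1) k := odflt k (unlift (s i) (s (lift i k))).
  have ulsfK i (s : 'S_n.+1) k: lift (s i) (ulsf i s k) = s (lift i k).
    rewrite /ulsf; have:= neq_lift i k.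
    by rewrite -(can_eq (permK s)) => /unlift_some[] ? ? ->.
  have inj_ulsf: injective (ulsf i0 _).
    move=> s; apply: can_inj (ulsf (s i0) s^-1%g) _ => k'.
    by rewrite {1}/ulsf ulsfK !permK liftK.
  exists (fun s => perm (inj_ulsf s)) => [s _ | s].
    by apply/permP=> k'; rewrite permE /ulsf lift_perm_lift lift_perm_id liftK.
  move/(s _ =P _) => si0; apply/permP=> k.
  case: (unliftP i0 k) => [k'|] ->; rewrite ?lift_perm_id //.
  by rewrite lift_perm_lift -si0 permE ulsfK.
rewrite /permanent.
apply: eq_big => [s | s _]; first by rewrite lift_perm_id eqxx.
case: (pickP 'I_n) => [k0 _ | n0]; last first.
  by rewrite !big1 // => [j /unlift_some[i] | i _]; have:= n0 i.
rewrite (reindex (lift i0)).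
  by apply: eq_big => [k | k _] /=; rewrite ?neq_lift // !mxE lift_perm_lift.
exists (fun k => odflt k0 (unlift i0 k)) => k; first by rewrite liftK.
by case/unlift_some=> k' -> ->.
Qed.

Lemma expand_permanent_row n (A : 'M[R]_n) i0 :
  permanent A = \sum_j A i0 j * permanent (row' i0 (col' j A)).
Proof.
rewrite /permanent (partition_big (fun s : 'S_n => s i0) predT) //=.
apply: eq_bigr => j0 _; rewrite -/(permanent _) expand_permanent_minor big_distrr /=.
apply: eq_bigr => s /eqP Dsi0.
rewrite (bigID (pred1 i0)) /= big_pred1_eq Dsi0; congr (_ * _).
by apply: eq_bigl => i; rewrite eq_sym.
Qed.

Lemma permanent_tr n (A : 'M[R]_n) : permanent A^T = permanent A.
Proof.
rewrite /permanent (reindex_inj invg_inj) /=.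
apply: eq_bigr => s _; rewrite (reindex_inj (@perm_inj _ s)) /=.
by apply: eq_bigr => i _; rewrite mxE permK.
Qed.

Lemma expand_permanent_col n (A : 'M[R]_n) j0 :
  permanent A = \sum_i A i j0 * permanent (row' i (col' j0 A)).
Proof.
rewrite -permanent_tr (expand_permanent_row _ j0); apply: eq_bigr => i _.
rewrite mxE -permanent_tr; congr (_ * permanent _).
by apply/matrixP => a b; rewrite !mxE.
Qed.

Lemma permanent_mx00 (A : 'M[R]_0) : permanent A = 1.
Proof.
rewrite /permanent (eq_bigr (fun _ => 1)) => [|s _]; last by rewrite big_ord0.
by rewrite sumr_const card_Sn.
Qed.

End Permanent.

Section Hessenberg.
Variable k : nat.
Notation P := {mpoly rat[k]}.

(* [f] fills the last row (read from the right), [s] the super-diagonal. *)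
Definition hessenberg m (f : nat -> P) (s : P) : 'M[P]_m :=
  \matrix_(i < m, j < m)
    if (i.+1 == m :> nat)%N then f (m - j)%N
    else if (j <= i)%N then tvar k (i - j).+1
    else if (j == i.+1 :> nat)%N then s
    else 0.

Lemma Hmat_hessenberg n w s :
  Hmat k n w s = hessenberg n (fun j => ((w j)%:~R : rat) *: tvar k j) s.
Proof. by []. Qed.

Lemma row'_col'_hessenberg_max p f s :
  row' ord_max (col' ord_max (hessenberg p.+2 f s)) = hessenberg p.+1 (tvar k) s.
Proof.
apply/matrixP => -[i hi] [j hj]; rewrite !mxE !lift_max /=.
have [|ne_ip2] := eqVneq i.+1 p.+2; first lia.
have [eq_ip1|//] := eqVneq i.+1 p.+1.
have -> : (j <= i)%N by lia.
congr (tvar k _); lia.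
Qed.

Lemma row'_col'_hessenberg_pred p f s :
  row' (inord p) (col' ord_max (hessenberg p.+2 f s)) =
    hessenberg p.+1 (fun j => f j.+1) s.
Proof.
apply/matrixP => -[i hi] [j hj]; rewrite !mxE lift_max.
have -> : (lift (inord p) (Ordinal hi) : nat) = if (i < p)%N then i else i.+1.
  by rewrite /= /bump inordK // leqNgt; case: ltnP.
rewrite /=; case: (ltnP i p) => lt_ip.
  have [|_] := eqVneq i.+1 p.+2; first lia.
  by have [|_] := eqVneq i.+1 p.+1; first lia.
have [_|] := eqVneq i.+2 p.+2; last lia.
have [_|] := eqVneq i.+1 p.+1; last lia.
congr f; lia.
Qed.

Lemma hessenberg_col_max p f s (i : 'I_p.+2) :
  hessenberg p.+2 f s i ord_max =
    if i == ord_max then f 1%N else if i == inord p then s else 0.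
Proof.
case: i => i hi.
have -> : (Ordinal hi == ord_max) = (i.+1 == p.+2).
  by apply/eqP/eqP => [/(congr1 val) /= H|H]; [lia | apply: val_inj => /=; lia].
have -> : (Ordinal hi == inord p) = (i == p).
  apply/eqP/eqP => [/(congr1 val) /= ->|eq_ip]; first by rewrite inordK.
  by apply: val_inj; rewrite /= inordK // -eq_ip.
rewrite !mxE /=; have [eq_ip2|ne_ip2] := eqVneq i.+1 p.+2.
  by have -> : (p.+2 - p.+1 = 1)%N by lia.
have -> : (p.+1 <= i)%N = false by lia.
by case: eqP => [|]; case: eqP => //; lia.
Qed.

Lemma sum_hessenberg_col_max p f s (g : 'I_p.+2 -> P) :
  \sum_i hessenberg p.+2 f s i ord_max * g i = f 1%N * g ord_max + s * g (inord p).
Proof.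
have ne_p_max : inord p != ord_max :> 'I_p.+2.
  by apply/eqP => /(congr1 val); rewrite /= inordK //; lia.
rewrite (bigD1 ord_max) // (bigD1 (inord p)) //= big1 ?addr0; last first.
  move=> i /andP[ne_i_max ne_i_p].
  by rewrite hessenberg_col_max (negbTE ne_i_max) (negbTE ne_i_p) mul0r.
by rewrite !hessenberg_col_max eqxx (negbTE ne_p_max) eqxx.
Qed.

Lemma permanent_hessenberg1 f s : permanent (hessenberg 1 f s) = f 1%N.
Proof. by rewrite (expand_permanent_col _ ord0) big_ord1 permanent_mx00 mulr1 mxE. Qed.

Lemma det_hessenberg1 f s : \det (hessenberg 1 f s) = f 1%N.
Proof. by rewrite (expand_det_col _ ord0) big_ord1 /cofactor det_mx00 mulr1 mulr1 mxE. Qed.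

Lemma permanent_hessenberg_rec p f :
  permanent (hessenberg p.+2 f 1) =
    f 1%N * permanent (hessenberg p.+1 (tvar k) 1)
    + permanent (hessenberg p.+1 (fun j => f j.+1) 1).
Proof.
rewrite (expand_permanent_col _ ord_max) sum_hessenberg_col_max.
by rewrite row'_col'_hessenberg_max row'_col'_hessenberg_pred mul1r.
Qed.

Lemma det_hessenberg_rec p f :
  \det (hessenberg p.+2 f (-1)) =
    f 1%N * \det (hessenberg p.+1 (tvar k) (-1))
    + \det (hessenberg p.+1 (fun j => f j.+1) (-1)).
Proof.
rewrite (expand_det_col _ ord_max) sum_hessenberg_col_max /cofactor.
rewrite row'_col'_hessenberg_max row'_col'_hessenberg_pred /= inordK //.
rewrite addnn -signr_odd odd_double mul1r mulrA -exprS -signr_odd.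
by rewrite addnS /= negbK addnn odd_double mul1r.
Qed.

End Hessenberg.

Lemma prod_fact_dvd_fact_sumn (s : seq nat) : (\prod_(x <- s) x`! %| (sumn s)`!)%N.
Proof.
elim: s => [|x s IHs]; first by rewrite big_nil.
rewrite big_cons /= -(bin_fact (leq_addr (sumn s) x)) addKn.
by rewrite dvdn_mull // dvdn_mul.
Qed.

Section MonomialMultinomial.
Variables (R : numFieldType) (k : nat).
Implicit Types m : 'X_{1..k}.

Definition mnm_multinomial m := multinomial [seq (m j : nat) | j <- enum 'I_k].

Lemma mnm_multinomialE m :
  (mnm_multinomial m)%:R = (mdeg m)`!%:R / (\prod_(j < k) (m j)`!)%:R :> R.
Proof.
rewrite /mnm_multinomial /multinomial natr_div.
- by rewrite mdegE sumnE !big_map.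
- exact: prod_fact_dvd_fact_sumn.
by rewrite unitfE pnatr_eq0 -lt0n prodn_gt0 // => i; rewrite fact_gt0.
Qed.

Lemma mnm_multinomial0 : (mnm_multinomial 0%MM)%:R = 1 :> R.
Proof. by rewrite mnm_multinomialE mdeg0 big1 ?divr1 // => j _; rewrite mnm0E. Qed.

Lemma mnmB1E m (i j : 'I_k) : (m - U_(i))%MM j = if i == j then (m j).-1 else m j.
Proof. by rewrite mnmBE mnm1E; case: eqP; rewrite ?subn1 ?subn0. Qed.

Lemma mdeg_subU m (j : 'I_k) : (0 < m j)%N -> mdeg m = (mdeg (m - U_(j))%MM).+1.
Proof.
move=> m_j_gt0; rewrite !mdegE (bigD1 j) //= [in RHS](bigD1 j) //= mnmB1E eqxx.
rewrite [in RHS](eq_bigr (fun i => m i)) => [|i /negbTE ne_ij]; last first.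
  by rewrite mnmB1E eq_sym ne_ij.
lia.
Qed.

Lemma mnm_multinomial_subU m (j : 'I_k) : (0 < m j)%N ->
  (mnm_multinomial (m - U_(j))%MM)%:R * (mdeg m)%:R =
    (mnm_multinomial m)%:R * (m j)%:R :> R.
Proof.
move=> m_j_gt0; rewrite !mnm_multinomialE (mdeg_subU m_j_gt0) factS.
rewrite (bigD1 j) //= [X in _ = _ / X%:R * _](bigD1 j) //= mnmB1E eqxx.
rewrite (eq_bigr (fun i => (m i)`!) (P := fun i => i != j)) => [|i /negbTE ne_ij]; last first.
  by rewrite mnmB1E eq_sym ne_ij.
have -> : m j = (m j).-1.+1 by lia.
rewrite factS /= !natrM.
field; rewrite addrC natr1 !pnatr_eq0 -!lt0n fact_gt0 andbT.
by rewrite prodn_gt0 // => i; rewrite fact_gt0.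
Qed.

End MonomialMultinomial.

Lemma mcoeffXM (R : comNzRingType) n (i : 'I_n) (p : {mpoly R[n]}) m :
  ('X_i * p)@_m = if (0 < m i)%N then p@_(m - U_(i))%MM else 0.
Proof.
rewrite mulrC; case: ifP => m_i_gt0.
  have {1}-> : m = (U_(i) + (m - U_(i)))%MM.
    by apply/mnmP => j; rewrite mnmDE mnmB1E mnm1E; case: eqP => [<-|]; lia.
  by rewrite mcoeffMX.
apply/eqP; rewrite mcoeff_eq0 (perm_mem (msuppMX _ _)).
by apply/mapP => -[m' _ Em]; move: m_i_gt0; rewrite Em mnmDE mnm1E eqxx.
Qed.

Lemma sum_ord_vanishing (V : nmodType) (h : nat -> V) N k :
  (forall i, (k <= i)%N -> h i = 0) -> \sum_(i < N) h i = \sum_(j < k | (j < N)%N) h j.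
Proof.
move=> h_vanishing.
rewrite (big_ord_widen_cond (N + k) (fun _ => true) h) ?leq_addr //.
rewrite [RHS](big_ord_widen_cond (N + k) (fun i => (i < N)%N) h) ?leq_addl //.
rewrite [LHS]big_mkcond [RHS]big_mkcond; apply: eq_bigr => i _ /=.
by case: (ltnP i N) => //=; case: (ltnP i k) => //= le_k_i _; rewrite h_vanishing.
Qed.

Section Coefficients.
Variable k : nat.
Notation P := {mpoly rat[k]}.
Implicit Types m : 'X_{1..k}.

Lemma tvar_ord (j : 'I_k) : tvar k j.+1 = 'X_j.
Proof.
rewrite /tvar /=; case: insubP => [i _ /= eq_ij|]; last by rewrite ltn_ord.
by congr ('X_ _); apply: val_inj.
Qed.

Lemma tvar_ge i : (k <= i)%N -> tvar k i.+1 = 0.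
Proof. by move=> le_k_i; rewrite /tvar /=; case: insubP => // i' lt_i_k _; lia. Qed.

(* [m j] is the exponent of t_(j+1), of weight j + 1. *)
Definition mwt m := (\sum_(j < k) j.+1 * m j)%N.

Lemma mwt_ge m (j : 'I_k) : (j.+1 * m j <= mwt m)%N.
Proof. by rewrite /mwt (bigD1 j) //= leq_addr. Qed.

Lemma mwt_eq0 m : (mwt m == 0%N) = (m == 0%MM).
Proof.
apply/eqP/eqP => [mwt_m0|->].
  by apply/mnmP => j; rewrite mnm0E; have := mwt_ge m j; rewrite mwt_m0; nia.
by rewrite /mwt big1 // => j _; rewrite mnm0E muln0.
Qed.

Lemma mwt_subU m (j : 'I_k) : (0 < m j)%N -> mwt m = (mwt (m - U_(j))%MM + j.+1)%N.
Proof.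
move=> m_j_gt0; rewrite /mwt (bigD1 j) //= [in RHS](bigD1 j) //= mnmB1E eqxx.
rewrite [in RHS](eq_bigr (fun i : 'I_k => i.+1 * m i)%N) => [|i /negbTE ne_ij].
  by nia.
by rewrite mnmB1E eq_sym ne_ij.
Qed.

Lemma mwt_subU_eq m d (j : 'I_k) : (0 < m j)%N ->
  ((j < d.+1)%N && (mwt (m - U_(j))%MM == d - j)%N) = (mwt m == d.+1).
Proof.
move=> m_j_gt0; have := mwt_subU m_j_gt0; have := mwt_ge m j.
by case: (ltnP j d.+1) => /= lt_jd mwt_ge_j mwtE; apply/eqP/eqP; nia.
Qed.

Lemma mdeg_neq0 m : mwt m != 0%N -> (mdeg m)%:R != 0 :> rat.
Proof. by rewrite pnatr_eq0 mdeg_eq0 mwt_eq0. Qed.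

Lemma mcoeff_tvar_conv (c : nat -> rat) (q : nat -> P) d :
  (forall e m, (e <= d)%N -> (q e)@_m = (mwt m == e)%:R * (mnm_multinomial m)%:R) ->
  forall m, (\sum_(i < d.+1) (c i.+1 *: tvar k i.+1) * q (d - i)%N)@_m =
    (mwt m == d.+1)%:R * ((mnm_multinomial m)%:R *
      ((\sum_(j < k) c j.+1 * (m j)%:R) / (mdeg m)%:R)).
Proof.
move=> qE m.
rewrite (@sum_ord_vanishing _ (fun i => (c i.+1 *: tvar k i.+1) * q (d - i)%N) _ k); last first.
  by move=> i le_k_i; rewrite tvar_ge // scaler0 mul0r.
have termE (j : 'I_k) : (j < d.+1)%N ->
    ((c j.+1 *: tvar k j.+1) * q (d - j)%N)@_m = (mwt m == d.+1)%:R *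
      (c j.+1 * if (0 < m j)%N then (mnm_multinomial (m - U_(j))%MM)%:R else 0).
  move=> lt_jd; rewrite tvar_ord -scalerAl mcoeffZ mcoeffXM mulrCA.
  case: ifP => m_j_gt0; rewrite ?mulr0 // qE; last by lia.
  by rewrite -(mwt_subU_eq d m_j_gt0) lt_jd.
rewrite raddf_sum (eq_bigr _ termE) -mulr_sumr.
have [mwt_m|_] := eqVneq (mwt m) d.+1; last by rewrite !mul0r.
have mdeg_m_neq0 : (mdeg m)%:R != 0 :> rat by rewrite mdeg_neq0 // mwt_m.
rewrite !mul1r big_mkcond /=; apply: (mulIf mdeg_m_neq0).
rewrite mulr_suml -mulrA divfK // mulr_sumr; apply: eq_bigr => j _.
have [m_j0|m_j_gt0] := posnP (m j); first by rewrite m_j0 !mulr0 if_same mul0r.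
have lt_jd : (j < d.+1)%N by have := mwt_subU m_j_gt0; lia.
by rewrite lt_jd -mulrA mnm_multinomial_subU // mulrCA.
Qed.

Lemma mcoeff_tvar_rec (q : nat -> P) : q 0%N = 1 ->
    (forall d, q d.+1 = \sum_(i < d.+1) tvar k i.+1 * q (d - i)%N) ->
  forall d m, (q d)@_m = (mwt m == d)%:R * (mnm_multinomial m)%:R.
Proof.
move=> q0 qS d; elim/ltn_ind: d => -[_ m|d IHd m].
  rewrite q0 mcoeff1 mwt_eq0; case: eqP => [->|_]; last by rewrite mul0r.
  by rewrite mnm_multinomial0 mulr1.
rewrite qS; under eq_bigr do rewrite -[tvar k _]scale1r.
rewrite (mcoeff_tvar_conv (fun=> 1)) => [|e m' le_ed]; last by apply: IHd; lia.
have [mwt_m|_] := eqVneq (mwt m) d.+1; last by rewrite !mul0r.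
under eq_bigr do rewrite mul1r.
by rewrite -natr_sum -mdegE divff ?mulr1 // mdeg_neq0 // mwt_m.
Qed.

Lemma mcoeff_Pw n w m : (Pw k n w)@_m = (mwt m == n)%:R * ((mnm_multinomial m)%:R *
    ((\sum_(j < k) ((w j.+1)%:~R : rat) * (m j)%:R) / (mdeg m)%:R)).
Proof.
rewrite /Pw raddf_sum /=.
pose mon (a : {ffun 'I_k -> 'I_n.+1}) := [multinom (a j : nat) | j < k].
have monX (a : {ffun 'I_k -> 'I_n.+1}) : \prod_(j < k) 'X_j ^+ a j = 'X_[mon a] :> P.
  by rewrite mpolyXE_id; apply: eq_bigr => j _; rewrite mnmE.
under eq_bigr => a _ do rewrite monX mcoeffZ mcoeffX.
have [mwt_m|ne_mwt_m] := eqVneq (mwt m) n; last first.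
  rewrite mul0r; apply: big1 => a /eqP mwt_a; case: eqP => [Em|]; last by rewrite mulr0.
  by case/eqP: ne_mwt_m; rewrite -Em -mwt_a; apply: eq_bigr => j _; rewrite mnmE.
have m_le_n j : (m j < n.+1)%N by have := mwt_ge m j; rewrite mwt_m; nia.
pose a0 : {ffun 'I_k -> 'I_n.+1} := [ffun j => Ordinal (m_le_n j)].
have a0E j : (a0 j : nat) = m j by rewrite ffunE.
have mon_a0 : mon a0 = m by apply/mnmP => j; rewrite mnmE a0E.
rewrite (bigD1 a0) /=; last first.
  by rewrite -[X in _ == X]mwt_m; apply/eqP; apply: eq_bigr => j _; rewrite a0E.
rewrite [\sum_(a | _ && (a != a0)) _]big1 ?addr0; last first.
  move=> a /andP[_ ne_a_a0]; case: eqP => [Em|]; last by rewrite mulr0.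
  case/eqP: ne_a_a0; apply/ffunP => j; apply: ord_inj; rewrite a0E.
  by have := congr1 (fun m' : 'X_{1..k} => m' j) Em; rewrite /= mnmE.
rewrite mon_a0 eqxx mulr1 mul1r /mnm_multinomial (eq_map a0E); congr (_ * (_ / _)).
  by apply: eq_bigr => j _; rewrite a0E.
by rewrite mdegE; congr (_%:R); apply: eq_bigr => j _; rewrite a0E.
Qed.

End Coefficients.

Section HessenbergRecursion.
Variable k : nat.
Notation P := {mpoly rat[k]}.
Variable F : nat -> (nat -> P) -> P.
Hypothesis F0 : forall f, F 0%N f = 1.
Hypothesis F1 : forall f, F 1%N f = f 1%N.
Hypothesis FS : forall p f,
  F p.+2 f = f 1%N * F p.+1 (tvar k) + F p.+1 (fun j => f j.+1).

Lemma hessenberg_unroll m f : F m.+1 f = \sum_(i < m.+1) f i.+1 * F (m - i)%N (tvar k).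
Proof.
elim: m f => [|m IHm] f; first by rewrite big_ord1 F1 F0 mulr1.
by rewrite FS (IHm (fun j => f j.+1)) [RHS]big_ord_recl subn0.
Qed.

Lemma hessenberg_weighted n w : (1 <= n)%N ->
  F n (fun j => ((w j)%:~R : rat) *: tvar k j) = Pw k n w.
Proof.
case: n => [//|n] _; apply/mpolyP => m.
have FtE := @mcoeff_tvar_rec _ (F^~ (tvar k)) (F0 _) (fun d => hessenberg_unroll d (tvar k)).
rewrite hessenberg_unroll mcoeff_Pw.
by rewrite (@mcoeff_tvar_conv _ (fun j => (w j)%:~R) (F^~ (tvar k))) // => e m' _; apply: FtE.
Qed.

End HessenbergRecursion.

Theorem theorem14 (k n : nat) (hk : (1 <= k)%N) (hn : (1 <= n)%N) (w : nat -> int) :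
  permanent (Hmat k n w 1) = Pw k n w /\ \det (Hmat k n w (-1)) = Pw k n w.
Proof.
rewrite !Hmat_hessenberg; split.
  apply: (@hessenberg_weighted k (fun m f => permanent (hessenberg m f 1))) => //.
  - by move=> f; apply: permanent_mx00.
  - by move=> f; apply: permanent_hessenberg1.
  - exact: permanent_hessenberg_rec.
apply: (@hessenberg_weighted k (fun m f => \det (hessenberg m f (-1)))) => //.
- by move=> f; apply: det_mx00.
- by move=> f; apply: det_hessenberg1.
- exact: det_hessenberg_rec.
Qed.
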